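(* Let $A, B \subset \mathbb{R}^n$ be set-germs at $0 \in \mathbb{R}^n$ such that $0 \in \overline{A} \cap \overline{B}$, and let $\phi : A \to B$ be a bi-Lipschitz homeomorphism (of germs at $0$). If both $A$ and $B$ satisfy condition $(SSP)$, then $d\tilde{\tilde{\phi}}(LD(A)) = LD(B)$, where $LD(A)$ is identified with $LD(A)\times\{0\} \subset \mathbb{R}^n\times\mathbb{R}^n$ and $LD(B)$ with $\{0\}\times LD(B) \subset \mathbb{R}^n\times\mathbb{R}^n$; that is, $d\tilde{\tilde{\phi}}(LD(A)\times\{0\}) = \{0\}\times LD(B)$.
   Context: For a set-germ $A$ at $0\in\mathbb{R}^n$ with $0\in\overline{A}$, the direction set is $$D(A) := \{a \in S^{n-1} \mid \exists \{x_i\} \subset A\setminus\{0\},\ x_i \to 0,\ \tfrac{x_i}{\|x_i\|}\to a \text{ as } i\to\infty\},$$ where $S^{n-1}$ is the unit sphere centred at $0$. The real tangent cone is $LD(A) := \{ta \in \mathbb{R}^n\mid a \in D(A),\ t\ge 0\}$. $A$ satisfies condition $(SSP)$ (sequence selection property) if for any sequence $\{a_m\}$ of (nonzero) points of $\mathbb{R}^n$ tending to $0$ with $\lim_{m\to\infty} \frac{a_m}{\|a_m\|}\in D(A)$, there is a sequence $\{b_m\}\subset A$ such that $\lim_{m\to\infty}\frac{\|a_m-b_m\|}{\|a_m\|}=0$ (equivalently, also $\|a_m-b_m\|\ll\|b_m\|$). A bi-Lipschitz homeomorphism $\phi:A\to B$ of germs at $0$ is a homeomorphism between representatives such that $\phi$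 and $\phi^{-1}$ are Lipschitz, with $\phi(x)\to 0$ as $x\to 0$ and $\phi^{-1}(y)\to 0$ as $y\to 0$. Construction of $\tilde{\tilde\phi}$ (doubling process): choose global Lipschitz extensions $\tilde\phi,\ \widetilde{\phi^{-1}}:\mathbb{R}^n\to\mathbb{R}^n$ of $\phi$ and $\phi^{-1}$. For a Lipschitz map $f:\mathbb{R}^n\to\mathbb{R}^n$ define bi-Lipschitz maps of $\mathbb{R}^n\times\mathbb{R}^n$ by $Y_+(f)(x,y) := (x,y+f(x))$ and $Y_-(f)(x,y) := (x+f(y),y)$. Set $\tilde{\tilde\phi} := Y_-(\widetilde{\phi^{-1}})^{-1}\circ Y_+(\tilde\phi)$, a bi-Lipschitz homeomorphism of $\mathbb{R}^n\times\mathbb{R}^n$ with $\tilde{\tilde\phi}(x,0)=(0,\phi(x))$ for all $x\in A$. Construction of $d\psi$: for a bi-Lipschitz homeomorphism $\psi:\mathbb{R}^N\to\mathbb{R}^N$ with $\psi(0)=0$, put $\psi_k(x) := k\,\psi(x/k)$ for $k\in\mathbb{N}$. By the Arzelà–Ascoli theorem there is a subsequence $\psi_{k_i}$ converging uniformly on compact sets; $d\psi$ denotes any such subsequential limit, and it is bi-Lipschitz with the same constants. Here this is applied with $N=2n$ and $\psi=\tilde{\tilde\phi}$. *)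

(* Defs.v *)
From HB Require Import structures.
From mathcomp Require Import all_boot all_order all_algebra.
From mathcomp Require Import all_classical all_reals all_analysis.

Set Implicit Arguments.
Unset Strict Implicit.
Unset Printing Implicit Defensive.

Import Order.TTheory GRing.Theory Num.Theory.
Import numFieldNormedType.Exports.

Local Open Scope classical_set_scope.
Local Open Scope ring_scope.

(* The library norm on 'rV[R]_n is the sup norm, so the Euclidean norm, which
   determines the unit sphere, is introduced separately. Both norms induce the
   topology that the library puts on 'rV[R]_n. *)
Definition enorm (R : realType) (n : nat) (x : 'rV[R]_n) : R :=
  Num.sqrt (\sum_(i < n) x ord0 i ^+ 2).

Definition direction (R : realType) (n : nat) (x : 'rV[R]_n) : 'rV[R]_n :=
  (enorm x)^-1 *: x.

Definition direction_set (R : realType) (n : nat) (A : set 'rV[R]_n) :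
    set 'rV[R]_n :=
  [set a | enorm a = 1 /\
    exists x : nat -> 'rV[R]_n,
      [/\ forall i, A (x i) /\ x i != 0,
          x i @[i --> \oo] --> (0 : 'rV[R]_n)
        & direction (x i) @[i --> \oo] --> a]].

Definition tangent_cone (R : realType) (n : nat) (A : set 'rV[R]_n) :
    set 'rV[R]_n :=
  [set v | exists a t, [/\ direction_set A a, 0 <= t & v = t *: a]].

Definition SSP (R : realType) (n : nat) (A : set 'rV[R]_n) : Prop :=
  forall (a : nat -> 'rV[R]_n) (l : 'rV[R]_n),
    (forall m, a m != 0) ->
    a m @[m --> \oo] --> (0 : 'rV[R]_n) ->
    direction_set A l ->
    direction (a m) @[m --> \oo] --> l ->
    exists b : nat -> 'rV[R]_n,
      (forall m, A (b m)) /\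
      enorm (a m - b m) / enorm (a m) @[m --> \oo] --> (0 : R).

(* A set-germ at 0 is handled through its representatives. *)
Definition same_germ (R : realType) (n : nat) (A A' : set 'rV[R]_n) : Prop :=
  \forall x \near (0 : 'rV[R]_n), A x <-> A' x.

(* The values of phi off A and of phiV off B are irrelevant. The library's
   [lipschitz _ | _ in _] asserts the existence of a Lipschitz constant; since
   all norms on 'rV[R]_n are equivalent, it is insensitive to the choice of the
   norm. *)
Definition bilipschitz_homeo (R : realType) (n : nat) (A B : set 'rV[R]_n)
    (phi phiV : 'rV[R]_n -> 'rV[R]_n) : Prop :=
  [/\ set_fun A B phi /\ set_fun B A phiV,
      {in A, cancel phi phiV} /\ {in B, cancel phiV phi},
      {within A, continuous phi} /\ {within B, continuous phiV},
      [lipschitz phi x | x in A] /\ [lipschitz phiV y | y in B]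
    & phi x @[x --> within A (nbhs (0 : 'rV[R]_n))] --> (0 : 'rV[R]_n) /\
      phiV y @[y --> within B (nbhs (0 : 'rV[R]_n))] --> (0 : 'rV[R]_n)].

Definition lipschitz_extension (R : realType) (n : nat) (A : set 'rV[R]_n)
    (f F : 'rV[R]_n -> 'rV[R]_n) : Prop :=
  lipschitz F /\ {in A, F =1 f}.

Definition Yplus (R : realType) (n : nat) (f : 'rV[R]_n -> 'rV[R]_n)
    (z : 'rV[R]_n * 'rV[R]_n) : 'rV[R]_n * 'rV[R]_n :=
  (z.1, z.2 + f z.1).

Definition Yminus (R : realType) (n : nat) (f : 'rV[R]_n -> 'rV[R]_n)
    (z : 'rV[R]_n * 'rV[R]_n) : 'rV[R]_n * 'rV[R]_n :=
  (z.1 + f z.2, z.2).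

Definition Yminus_inv (R : realType) (n : nat) (f : 'rV[R]_n -> 'rV[R]_n)
    (z : 'rV[R]_n * 'rV[R]_n) : 'rV[R]_n * 'rV[R]_n :=
  (z.1 - f z.2, z.2).

Lemma YminusK (R : realType) (n : nat) (f : 'rV[R]_n -> 'rV[R]_n) :
  cancel (Yminus f) (Yminus_inv f).
Proof. by case=> x y; rewrite /Yminus /Yminus_inv /= addrK. Qed.

Lemma Yminus_invK (R : realType) (n : nat) (f : 'rV[R]_n -> 'rV[R]_n) :
  cancel (Yminus_inv f) (Yminus f).
Proof. by case=> x y; rewrite /Yminus /Yminus_inv /= subrK. Qed.

Definition doubling (R : realType) (n : nat) (F G : 'rV[R]_n -> 'rV[R]_n) :
    'rV[R]_n * 'rV[R]_n -> 'rV[R]_n * 'rV[R]_n :=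
  Yminus_inv G \o Yplus F.

Lemma doublingE (R : realType) (n : nat) (A B : set 'rV[R]_n)
    (phi phiV F G : 'rV[R]_n -> 'rV[R]_n) (x : 'rV[R]_n) :
  bilipschitz_homeo A B phi phiV ->
  lipschitz_extension A phi F -> lipschitz_extension B phiV G ->
  A x -> doubling F G (x, 0) = (0, phi x).
Proof.
move=> [[AB _] [phiK _] _ _ _] [_ Fphi] [_ GphiV] Ax.
rewrite /doubling /Yminus_inv /Yplus /= add0r.
by rewrite Fphi ?inE// GphiV ?inE ?phiK ?inE ?subrr//; exact: AB.
Qed.

Definition rescale (R : realType) (V : normedModType R) (psi : V -> V)
    (k : nat) (x : V) : V :=
  k%:R *: psi (k%:R^-1 *: x).

(* [dpsi] is one of the possible maps d psi. The junk value [rescale psi 0] does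
   not matter, since [k] is strictly increasing. *)
Definition is_dpsi (R : realType) (V : normedModType R) (psi dpsi : V -> V) :
    Prop :=
  exists k : nat -> nat, {homo k : i j / (i < j)%N} /\
    {family compact, (fun i => rescale psi (k i)) @ \oo --> dpsi}.

(* Main.v *)
Require Import Defs.
From HB Require Import structures.
From mathcomp Require Import all_boot all_order all_algebra.
From mathcomp Require Import all_classical all_reals all_analysis.

Set Implicit Arguments.
Unset Strict Implicit.
Unset Printing Implicit Defensive.

Import Order.TTheory GRing.Theory Num.Theory.
Import numFieldNormedType.Exports.

Local Open Scope classical_set_scope.
Local Open Scope ring_scope.

(** The theorem is a statement about blow-ups along the scales c m = k (m + 1)
    that define d psi. The doubled map psi = doubling F G is explicit,
      psi (x, y) = (x - G (y + F x), y + F x),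
    so evaluating its rescalings at (v, 0) and at (0, w) shows that the
    rescalings c F (v / c) and c G (w / c) converge pointwise: the first to
    Finf v, the second component of d psi (v, 0), the second to Ginf w, the
    opposite of the first component of d psi (0, w). Both Finf and Ginf thus
    exist without extracting a further subsequence.

    The heart is [blowup_map_tangent_cone]. Let v be a nonzero vector of LD(A).
    The points v / c m tend to 0 in a direction of D(A), so condition (SSP)
    gives points b m of A with c m * b m --> v ([SSP_blowup]). As F is Lipschitz,
    c m * F (b m) has the same limit Finf v as c m * F (v / c m)
    ([blowup_lipschitz]). But F (b m) = phi (b m) lies in B, so Finf v is in LD(B)
    ([blowup_tangent_cone]), provided it is not 0. Likewise
    b m = G (F (b m)), and since G is Lipschitz, c G (Finf v / c) --> v; in
    particular Finf v <> 0 when v <> 0. So Finf maps LD(A) to LD(B) and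
    Ginf (Finf v) = v there; exchanging the roles of A and B, Ginf maps LD(B) to
    LD(A) and Finf (Ginf w) = w.

    Finally, for v in LD(A), the first component v - c G (F (v / c)) of the
    rescaled map tends to v - v = 0, so d psi (v, 0) = (0, Finf v), and the two
    inclusions follow from the two inverse bijections. *)

(** * The Euclidean norm and the direction of a vector *)

Lemma enorm_ge0 (R : realType) (n : nat) (x : 'rV[R]_n) : 0 <= enorm x.
Proof. exact: sqrtr_ge0. Qed.

Lemma enorm_eq0 (R : realType) (n : nat) (x : 'rV[R]_n) :
  (enorm x == 0) = (x == 0).
Proof.
have sq_ge0 (i : 'I_n) : true -> 0 <= x ord0 i ^+ 2 by rewrite sqr_ge0.
apply/eqP/eqP => [/eqP|->]; last first.
  by rewrite /enorm big1 ?sqrtr0// => i _; rewrite mxE expr0n.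
rewrite sqrtr_eq0 => sum_le0; apply/rowP => i; rewrite mxE; apply/eqP.
rewrite -sqrf_eq0 (psumr_eq0P sq_ge0)//.
by apply/eqP; rewrite eq_le sum_le0 sumr_ge0.
Qed.

Lemma enorm_gt0 (R : realType) (n : nat) (x : 'rV[R]_n) :
  (0 < enorm x) = (x != 0).
Proof. by rewrite lt_def enorm_ge0 andbT enorm_eq0. Qed.

Lemma enormZ (R : realType) (n : nat) (c : R) (x : 'rV[R]_n) :
  enorm (c *: x) = `|c| * enorm x.
Proof.
rewrite /enorm -sqrtr_sqr -sqrtrM ?sqr_ge0// mulr_sumr.
by congr Num.sqrt; apply: eq_bigr => i _; rewrite mxE exprMn.
Qed.

(** Condition (SSP) controls Euclidean norms, whereas the topology of row
    vectors is that of the sup norm; this is the half of the equivalence of norms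
    needed to pass from the former to the latter. *)
Lemma le_norm_enorm (R : realType) (n : nat) (x : 'rV[R]_n) : `|x| <= enorm x.
Proof.
rewrite [leLHS]/Num.Def.normr/= mx_normrE (bigmax_le _ (enorm_ge0 x))//=.
move=> [i j] _ /=; rewrite (ord1 i) -sqrtr_sqr /enorm ler_wsqrtr//.
by rewrite (bigD1 j)//= lerDl sumr_ge0// => k _; exact: sqr_ge0.
Qed.

Lemma enorm_continuous (R : realType) (n : nat) : continuous (@enorm R n).
Proof.
move=> x.
have sum_cvg : \sum_(i < n) y ord0 i ^+ 2 @[y --> x] -->
    (\sum_(i < n) x ord0 i ^+ 2 : R).
  apply: (@cvg_big _ _ +%R _ _ _ 'rV[R]_n (nbhs x)).
    exact: add_continuous.
  by move=> i _; apply: cvgM; exact: coord_continuous.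
exact: (cvg_comp _ _ sum_cvg (@sqrt_continuous R _)).
Qed.

Lemma directionZ (R : realType) (n : nat) (c : R) (x : 'rV[R]_n) :
  0 < c -> direction (c *: x) = direction x.
Proof.
move=> c0; rewrite /direction enormZ gtr0_norm// scalerA invfM.
by rewrite mulrAC mulVf ?mul1r// gt_eqF.
Qed.

Lemma enorm_direction (R : realType) (n : nat) (x : 'rV[R]_n) :
  x != 0 -> enorm (direction x) = 1.
Proof.
move=> x0; rewrite enormZ ger0_norm ?invr_ge0 ?enorm_ge0//.
by rewrite mulVf// enorm_eq0.
Qed.

Lemma scale_direction (R : realType) (n : nat) (x : 'rV[R]_n) :
  x != 0 -> enorm x *: direction x = x.
Proof. by move=> x0; rewrite scalerA mulfV ?scale1r// enorm_eq0. Qed.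

Lemma direction_continuous (R : realType) (n : nat) (x : 'rV[R]_n) :
  x != 0 -> {for x, continuous (@direction R n)}.
Proof.
move=> x0.
apply: (@cvgZ _ _ _ (nbhs x) _ (fun y => (enorm y)^-1) id); last exact: cvg_id.
by apply: (@cvgV _ _ (nbhs x)); [rewrite enorm_eq0|exact: enorm_continuous].
Qed.

(** * Real tangent cones *)

Lemma tangent_cone_direction (R : realType) (n : nat) (A : set 'rV[R]_n) a :
  direction_set A a -> tangent_cone A a.
Proof. by move=> Da; exists a, 1; rewrite scale1r. Qed.

(** The cone of an empty direction set is empty, so the origin has to be obtained
    from some other vector of the cone. *)
Lemma tangent_cone0 (R : realType) (n : nat) (A : set 'rV[R]_n) v :
  tangent_cone A v -> tangent_cone A 0.
Proof. by move=> [a [t [Da _ _]]]; exists a, 0; rewrite scale0r. Qed.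

Lemma direction_tangent_cone (R : realType) (n : nat) (A : set 'rV[R]_n) v :
  v != 0 -> tangent_cone A v -> direction_set A (direction v).
Proof.
move=> v0 [a [t [Da t0 vE]]]; rewrite vE directionZ.
  by case: (Da) => a1 _; rewrite /direction a1 invr1 scale1r.
by rewrite lt_def t0 andbT; apply: contraNneq v0 => t0'; rewrite vE t0' scale0r.
Qed.

(** * Lipschitz maps *)

Lemma lipschitz_bound (R : realType) (V W : normedModType R) (F : V -> W) :
  lipschitz F ->
  exists2 M : R, 0 <= M & forall x y, `|F x - F y| <= M * `|x - y|.
Proof.
move=> lipF.
have /filter_ex[M [M0 MP]] : \forall M \near (+oo : set_system R),
    0 <= M /\ M.-lipschitz F.
  near=> M; split; near: M; [exact: nbhs_pinfty_ge|exact: lipF].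
by exists M => // x y; exact: (MP (x, y)).
Unshelve. all: by end_near. Qed.

Lemma lipschitz_continuous (R : realType) (V W : normedModType R) (F : V -> W) :
  lipschitz F -> continuous F.
Proof.
move=> /lipschitz_bound[M M0 FM] x.
apply: (@cvg_sub0 _ _ _ _ _ _ (cst (F x))); last exact: cvg_cst.
apply: norm_cvg0; apply: (@squeeze_cvgr _ _ _ _ (cst 0) (fun y => M * `|y - x|)).
- by near=> y; rewrite normr_ge0 /= FM.
- exact: cvg_cst.
- rewrite -[X in _ --> X](mulr0 M) -[in X in _ --> X](normr0 V) -(subrr x).
  apply: cvgM; first exact: cvg_cst.
  by apply: cvg_norm; apply: cvgB; [exact: cvg_id|exact: cvg_cst].
Unshelve. all: by end_near. Qed.

(** * Blow-ups along a sequence of scales *)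

(** A Lipschitz map cannot tell apart two sequences that agree to first order at
    the scale c: the distance between c * F x and c * F y is at most M times the
    one between c * x and c * y. *)
Lemma blowup_lipschitz (R : realType) (V W : normedModType R) (F : V -> W)
    (c : nat -> R) (x y : nat -> V) (v : V) (w : W) :
  lipschitz F ->
  c m *: x m @[m --> \oo] --> v -> c m *: y m @[m --> \oo] --> v ->
  c m *: F (x m) @[m --> \oo] --> w -> c m *: F (y m) @[m --> \oo] --> w.
Proof.
move=> /lipschitz_bound[M M0 FM] cx cy cFx.
apply: cvg_sub0 cFx; apply: norm_cvg0.
apply: (@squeeze_cvgr _ _ _ _ (cst 0)
  (fun m => M * `|c m *: y m - c m *: x m|)).
- near=> m; rewrite normr_ge0/= !fctE -!scalerBr !normrZ mulrCA.
  by rewrite ler_wpM2l.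
- exact: cvg_cst.
- rewrite -[X in _ --> X](mulr0 M) -[in X in _ --> X](normr0 V) -(subrr v).
  by apply: cvgM; [exact: cvg_cst|apply: cvg_norm; exact: cvgB].
Unshelve. all: by end_near. Qed.

Lemma blowup_cvg0 (R : realType) (V : normedModType R) (c : nat -> R)
    (x : nat -> V) (v : V) :
  (forall m, 0 < c m) -> c m @[m --> \oo] --> +oo ->
  c m *: x m @[m --> \oo] --> v -> x m @[m --> \oo] --> 0.
Proof.
move=> c0 coo cx; rewrite -(scale0r v).
rewrite (_ : x = fun m => (c m)^-1 *: (c m *: x m)); last first.
  by apply/funext => m; rewrite scalerA mulVf ?scale1r// gt_eqF.
apply: cvgZ cx; apply/gtr0_cvgV0 => //; exact: nearW.
Qed.

(** Directions are invariant under positive scaling, so the direction of x m is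
    that of c m *: x m and tends to the direction of w. *)
Lemma blowup_tangent_cone (R : realType) (n : nat) (A : set 'rV[R]_n)
    (c : nat -> R) (x : nat -> 'rV[R]_n) (w : 'rV[R]_n) :
  (forall m, 0 < c m) -> c m @[m --> \oo] --> +oo ->
  (\forall m \near \oo, A (x m)) -> c m *: x m @[m --> \oo] --> w ->
  w != 0 -> tangent_cone A w.
Proof.
move=> c0 coo Ax cx w0.
exists (direction w), (enorm w); split; last by rewrite scale_direction.
  split; first exact: enorm_direction.
  have [N _ NP] : \forall m \near \oo, A (x m) /\ x m != 0.
    near=> m; split; first by near: m.
    have : c m *: x m != 0 by near: m; exact: cvgr_neq0 cx w0.
    by apply: contraNneq => ->; rewrite scaler0.
  (* a direction needs a sequence that lies in A minus 0 from its first term *)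
  exists (fun m => x (m + N)%N); split.
  - by move=> i; apply: NP; rewrite /= leq_addl.
  - rewrite (cvg_shiftn N x); exact: blowup_cvg0 cx.
  - rewrite (cvg_shiftn N (fun m => direction (x m))).
    under eq_cvg => m do rewrite -(directionZ _ (c0 m)).
    exact: (continuous_cvg _ (direction_continuous w0)).
exact: enorm_ge0.
Unshelve. all: by end_near. Qed.

(** Condition (SSP), applied to the sequence v / c m of constant direction,
    realizes every nonzero tangent vector as a limit along scales that are
    prescribed in advance, not just along some scales. *)
Lemma SSP_blowup (R : realType) (n : nat) (A : set 'rV[R]_n)
    (c : nat -> R) (v : 'rV[R]_n) :
  (forall m, 0 < c m) -> c m @[m --> \oo] --> +oo ->
  SSP A -> tangent_cone A v -> v != 0 ->
  exists2 b : nat -> 'rV[R]_n,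
    (forall m, A (b m)) & c m *: b m @[m --> \oo] --> v.
Proof.
move=> c0 coo sspA LDv v0.
have cV0 m : 0 < (c m)^-1 by rewrite invr_gt0.
have cK m (u : 'rV[R]_n) : c m *: ((c m)^-1 *: u) = u.
  by rewrite scalerA mulfV ?scale1r// gt_eqF.
have [||||b [Ab bP]] := sspA (fun m => (c m)^-1 *: v) (direction v).
- by move=> m; rewrite scaler_eq0 negb_or v0 gt_eqF.
- apply: (@blowup_cvg0 _ _ c _ v) => //.
  by under eq_cvg do rewrite cK; exact: cvg_cst.
- exact: direction_tangent_cone.
- by under eq_cvg do rewrite directionZ//; exact: cvg_cst.
exists b => //; apply: (@cvg_sub0 _ _ _ _ _ _ (cst v)); last exact: cvg_cst.
apply: norm_cvg0.
apply: (@squeeze_cvgr _ _ _ _ (cst 0)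
  (fun m => enorm v * (enorm ((c m)^-1 *: v - b m) / enorm ((c m)^-1 *: v)))).
- (* at a = v / c, enorm (c (a - b)) is enorm v times enorm (a - b) / enorm a *)
  near=> m; rewrite normr_ge0/= !fctE distrC (le_trans (le_norm_enorm _))//.
  rewrite -[X in X - _](cK m) -scalerBr enormZ [enorm (_ *: v)]enormZ.
  rewrite !gtr0_norm// invfM invrK mulrCA [enorm v * _]mulrCA.
  by rewrite divff ?enorm_eq0// mulr1 mulrC.
- exact: cvg_cst.
- rewrite -[X in _ --> X](mulr0 (enorm v)).
  by apply: cvgM => //; exact: cvg_cst.
Unshelve. all: by end_near. Qed.

(** Tangent vectors of A are limits of rescaled points of A by (SSP), so Finf maps
    them to limits of rescaled points of B, and the blow-up of G brings them back.
    The statement is symmetric in (A, F) and (B, G) in order to be used in both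
    directions. *)
Lemma blowup_map_tangent_cone (R : realType) (n : nat) (A B : set 'rV[R]_n)
    (F G Finf : 'rV[R]_n -> 'rV[R]_n) (c : nat -> R) :
  (forall m, 0 < c m) -> c m @[m --> \oo] --> +oo ->
  lipschitz F -> lipschitz G -> F 0 = 0 -> G 0 = 0 ->
  (\forall x \near (0 : 'rV[R]_n), A x -> B (F x) /\ G (F x) = x) ->
  SSP A ->
  (forall v, c m *: F ((c m)^-1 *: v) @[m --> \oo] --> Finf v) ->
  forall v, tangent_cone A v ->
    tangent_cone B (Finf v) /\
    c m *: G ((c m)^-1 *: Finf v) @[m --> \oo] --> v.
Proof.
move=> c0 coo lipF lipG F0 G0 AB sspA FinfP.
have cK (u : 'rV[R]_n) : c m *: ((c m)^-1 *: u) @[m --> \oo] --> u.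
  under eq_cvg do rewrite scalerA mulfV ?scale1r ?gt_eqF//.
  exact: cvg_cst.
have Finf0 : Finf 0 = 0.
  apply: (cvg_unique (@norm_hausdorff _ _) (FinfP 0)).
  by rewrite /=; under eq_cvg do rewrite scaler0 F0 scaler0; exact: cvg_cst.
have main v : v != 0 -> tangent_cone A v -> tangent_cone B (Finf v) /\
    c m *: G ((c m)^-1 *: Finf v) @[m --> \oo] --> v.
  move=> v0 LDv; have [b Ab cb] := SSP_blowup c0 coo sspA LDv v0.
  have b0 := blowup_cvg0 c0 coo cb.
  have BF : \forall m \near \oo, B (F (b m)) /\ G (F (b m)) = b m.
    have : \forall m \near \oo, A (b m) -> B (F (b m)) /\ G (F (b m)) = b m.
      exact: b0 AB.
    by apply: filterS => m; exact.
  have cFb := blowup_lipschitz lipF (cK v) cb (FinfP v).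
  have cG : c m *: G ((c m)^-1 *: Finf v) @[m --> \oo] --> v.
    apply: (blowup_lipschitz lipG cFb (cK _)).
    apply: cvg_trans cb; apply: near_eq_cvg.
    by apply: filterS BF => m [_ ->].
  split=> //; apply: (blowup_tangent_cone c0 coo _ cFb).
    by apply: filterS BF => m [].
  apply: contraNneq v0 => Fv0; apply/eqP.
  apply: (cvg_unique (@norm_hausdorff _ _) cG).
  by rewrite /=; under eq_cvg do rewrite Fv0 scaler0 G0 scaler0; exact: cvg_cst.
move=> v LDv; have [v0|] := eqVneq v 0; last by move=> /main; exact.
rewrite v0 Finf0; split; last first.
  by under eq_cvg do rewrite scaler0 G0 scaler0; exact: cvg_cst.
(* the image of a unit tangent vector of A shows that LD(B) is not empty *)
have [a [t [Da _ _]]] := LDv.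
have a0 : a != 0 by rewrite -enorm_gt0; case: Da => -> _; exact: ltr01.
by have [/tangent_cone0] := main _ a0 (tangent_cone_direction Da).
Qed.

(** * Extensions of a homeomorphism of germs *)

(** The limit of f at 0 along A' is F 0 by continuity of F, and it is unique
    because 0 is in the closure of A'. *)
Lemma lipschitz_extension0 (R : realType) (n : nat) (A A' : set 'rV[R]_n)
    (f F : 'rV[R]_n -> 'rV[R]_n) :
  closure A 0 -> same_germ A A' -> lipschitz_extension A' f F ->
  f x @[x --> within A' (nbhs (0 : 'rV[R]_n))] --> (0 : 'rV[R]_n) -> F 0 = 0.
Proof.
move=> clA germA [lipF Ff] f0.
have clA' : closure A' 0.
  move=> U U0; have [x [Ax [Ux AA']]] := clA _ (filterI U0 germA).
  by exists x; split => //; exact/AA'.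
have properA' := within_nbhs_proper clA'.
have fF0 : f x @[x --> within A' (nbhs (0 : 'rV[R]_n))] --> F 0.
  apply: (@cvg_trans _ (F x @[x --> within A' (nbhs (0 : 'rV[R]_n))])).
    apply: near_eq_cvg.
    by apply: filterS (withinT A' (nbhs_filter _)) => x A'x; rewrite Ff ?inE.
  by apply: cvg_within_filter; exact: lipschitz_continuous.
exact: (cvg_unique (@norm_hausdorff _ _) fF0 f0).
Qed.

(** The homeomorphism relates the representatives A' and B' only; as F is
    continuous and fixes 0, the points F x also stay where B and B' agree. *)
Lemma extension_germ (R : realType) (n : nat) (A B A' B' : set 'rV[R]_n)
    (phi phiV F G : 'rV[R]_n -> 'rV[R]_n) :
  same_germ A A' -> same_germ B B' ->
  set_fun A' B' phi -> {in A', cancel phi phiV} ->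
  lipschitz_extension A' phi F -> lipschitz_extension B' phiV G -> F 0 = 0 ->
  \forall x \near (0 : 'rV[R]_n), A x -> B (F x) /\ G (F x) = x.
Proof.
move=> germA germB phiAB phiK [lipF Fphi] [_ GphiV] F0.
have BF : \forall x \near (0 : 'rV[R]_n), B (F x) <-> B' (F x).
  have Fcont : F x @[x --> (0 : 'rV[R]_n)] --> F 0.
    exact: lipschitz_continuous.
  by apply: (Fcont (fun y => B y <-> B' y)); rewrite F0.
move: germA BF; rewrite /same_germ; apply: filterS2 => x AA' BB' /AA' A'x.
have B'Fx : B' (F x) by rewrite Fphi ?inE//; exact: phiAB.
by split; [exact/BB'|rewrite GphiV ?inE// Fphi ?inE// phiK ?inE].
Qed.

(** * The blow-up of the doubled homeomorphism *)

(* A' and B' are the representatives of the germs A and B between which the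
   homeomorphism phi, with inverse phiV, is defined. *)
Theorem theorem3p6 (R : realType) (n : nat) (A B A' B' : set 'rV[R]_n)
    (phi phiV F G : 'rV[R]_n -> 'rV[R]_n)
    (dpsi : 'rV[R]_n * 'rV[R]_n -> 'rV[R]_n * 'rV[R]_n)
    (clA : closure A 0) (clB : closure B 0)
    (repA : same_germ A A') (repB : same_germ B B')
    (phi_homeo : bilipschitz_homeo A' B' phi phiV)
    (extF : lipschitz_extension A' phi F)
    (extG : lipschitz_extension B' phiV G)
    (sspA : SSP A) (sspB : SSP B)
    (dpsiP : is_dpsi (doubling F G) dpsi) :
  dpsi @` (tangent_cone A `*` [set 0]) = [set 0] `*` tangent_cone B.
Proof.
have [[phiAB phiVBA] [phiK phiVK] _ _ [phi0 phiV0]] := phi_homeo.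
have F0 := lipschitz_extension0 clA repA extF phi0.
have G0 := lipschitz_extension0 clB repB extG phiV0.
have [lipF _] := extF; have [lipG _] := extG.
have [k [k_homo psi_cvg]] := dpsiP.
have k_ge m : (m <= k m)%N.
  by elim: m => // m IH; exact: leq_ltn_trans IH (k_homo _ _ (ltnSn m)).
(* shifting the index by one makes every scale positive *)
pose c m : R := (k m.+1)%:R.
have c0 m : 0 < c m by rewrite ltr0n; exact: leq_trans (k_ge m.+1).
have coo : c m @[m --> \oo] --> +oo.
  apply/cvgryPge => M; near=> m; apply: (@le_trans _ _ m%:R).
    by near: m; exact: nbhs_infty_ger.
  by rewrite ler_nat; exact: leq_trans (leqnSn m) (k_ge _).
have dpsi_cvg z : c m *: doubling F G ((c m)^-1 *: z) @[m --> \oo] --> dpsi z.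
  have : {ptws, (fun i => rescale (doubling F G) (k i)) @ \oo --> dpsi}.
    exact: pointwise_cvg_compact_family psi_cvg.
  move=> /pointwise_cvgP/(_ z).
  by rewrite -(cvg_shiftS (fun m => rescale (doubling F G) (k m) z)).
have doubling_cvg x y :
    c m *: (((c m)^-1 *: x) - G ((c m)^-1 *: y + F ((c m)^-1 *: x)))
      @[m --> \oo] --> (dpsi (x, y)).1 /\
    c m *: ((c m)^-1 *: y + F ((c m)^-1 *: x)) @[m --> \oo] --> (dpsi (x, y)).2.
  split.
    exact: (cvg_comp _ _ (dpsi_cvg (x, y)) (@cvg_fst _ _ _ _ _)).
  exact: (cvg_comp _ _ (dpsi_cvg (x, y)) (@cvg_snd _ _ _ _ _)).
pose Finf v := (dpsi (v, 0)).2; pose Ginf w := - (dpsi (0, w)).1.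
have F_cvg v : c m *: F ((c m)^-1 *: v) @[m --> \oo] --> Finf v.
  by have [_] := doubling_cvg v 0; under eq_cvg do rewrite scaler0 add0r.
have G_cvg w : c m *: G ((c m)^-1 *: w) @[m --> \oo] --> Ginf w.
  have [/cvgN + _] := doubling_cvg 0 w.
  by under eq_cvg do rewrite /= fctE scaler0 F0 addr0 sub0r scalerN opprK.
have mapA := blowup_map_tangent_cone c0 coo lipF lipG F0 G0
  (extension_germ repA repB phiAB phiK extF extG F0) sspA F_cvg.
have mapB := blowup_map_tangent_cone c0 coo lipG lipF G0 F0
  (extension_germ repB repA phiVBA phiVK extG extF G0) sspB G_cvg.
have cK (u : 'rV[R]_n) : c m *: ((c m)^-1 *: u) @[m --> \oo] --> u.
  under eq_cvg do rewrite scalerA mulfV ?scale1r ?gt_eqF//.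
  exact: cvg_cst.
have dpsiE v : tangent_cone A v -> dpsi (v, 0) = (0, Finf v).
  move=> /mapA[_ cG]; rewrite [LHS]surjective_pairing; congr pair.
  have [+ _] := doubling_cvg v 0.
  under eq_cvg do rewrite scaler0 add0r scalerBr.
  move=> /cvg_unique; apply; first exact: norm_hausdorff.
  rewrite /= -(subrr v); apply: cvgB => //.
  exact: blowup_lipschitz lipG (cK _) (F_cvg v) cG.
apply/seteqP; split.
  move=> _ [[v _] [/= LDv ->] <-]; rewrite dpsiE//.
  by split=> //=; have [] := mapA _ LDv.
move=> [_ w] [/= -> LDw]; have [LDG cF] := mapB _ LDw.
exists (Ginf w, 0) => //; rewrite dpsiE//; congr pair.
exact: (cvg_unique (@norm_hausdorff _ _) (F_cvg _) cF).
Unshelve. all: by end_near. Qed.
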